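(* Let $\mathcal{E}$ be a separable Banach space of analytic functions on $\mathbb{D}$ with the following properties: (E) the evaluation functional $ev_z: f\mapsto f(z)$ is continuous on $\mathcal{E}$ for every $z\in\mathbb{D}$; (P) the polynomials are dense in $\mathcal{E}$ (in particular they belong to $\mathcal{E}$); (C) the $n$-th coefficient functionals $k_n$ satisfy $\sup_{n\ge0}\|k_n\|_{\mathcal{E}^*}\|z^n\|_{\mathcal{E}}<\infty$. Let $w=(w_n)_{n\ge1}$ be a sequence of non-zero complex numbers such that $B_w$ is continuous on $\mathcal{E}$. Then $B_w$ is hypercyclic on $\mathcal{E}$ if and only if $$\liminf_{n\to\infty}\left(\frac{1}{|w_1\cdots w_n|}\|z^n\|_{\mathcal{E}}\right)=0.$$ Also, $B_w$ is mixing on $\mathcal{E}$ if and only if $$\lim_{n\to\infty}\left(\frac{1}{|w_1\cdots w_n|}\|z^n\|_{\mathcal{E}}\right)=0.$$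
   Context: $\mathbb{D}$ is the open unit disc in $\mathbb{C}$. The $n$-th coefficient functional is $k_n(f)=f^{(n)}(0)/n!$, $n\ge0$. The weighted backward shift is $B_w\big(\sum_{n\ge0}\lambda_n z^n\big)=\sum_{n\ge0}w_{n+1}\lambda_{n+1}z^n$. A bounded operator $T$ on a separable Banach space $X$ is hypercyclic if some $x\in X$ has dense orbit $\{x,Tx,T^2x,\dots\}$; it is (topologically) mixing if for any two non-empty open sets $U_1,U_2\subseteq X$ the set $\{k\in\mathbb{N}: T^k(U_1)\cap U_2\ne\varnothing\}$ is co-finite. Throughout, weight sequences $w$ have non-zero terms. *)

(* Defs.v *)
From mathcomp Require Import all_boot all_order all_algebra.
From mathcomp Require Import complex.
From mathcomp Require Import all_classical all_reals all_analysis.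

Set Implicit Arguments.
Unset Strict Implicit.
Unset Printing Implicit Defensive.

Import Order.TTheory GRing.Theory Num.Theory.
Import numFieldNormedType.Exports.
Local Open Scope classical_set_scope.
Local Open Scope ring_scope.

(* Packaging R[i] as a [numClosedFieldType] is what gives it the canonical
   topology and normed-module structure induced by its modulus. *)
Definition Cplx (R : realType) : numClosedFieldType := R[i].

(* Norms over [Cplx R] take their values in [Cplx R], where they are real
   (nonnegative) complex numbers; [rnorm] is the norm as an element of [R]. *)
Definition rnorm (R : realType) (V : normedModType (Cplx R)) (x : V) : R :=
  complex.Re (`|x| : R[i]).

Definition unit_disc (R : realType) : set (Cplx R) := [set z | `|z| < 1].

(* At every point of [D], [f] is locally the sum of a convergent power series. *)
Definition analytic_on (R : realType) (D : set (Cplx R))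
    (f : Cplx R -> Cplx R) : Prop :=
  forall z0, D z0 -> exists a : nat -> Cplx R,
    \forall z \near z0, series (fun n => a n * (z - z0) ^+ n) @ \oo --> f z.

Definition separable_space (T : topologicalType) : Prop :=
  exists A : set T, countable A /\ dense A.

(* A vector space of analytic functions on the disc: [ev f] is the function
   underlying [f : E], and an element of [E] is determined by its values on the
   disc. The values of [ev f] off the disc are irrelevant. *)
Definition analytic_function_space (R : realType)
    (E : normedModType (Cplx R)) (ev : E -> Cplx R -> Cplx R) : Prop :=
  [/\ forall z, @unit_disc R z -> forall (c : Cplx R) (f g : E),
        ev (c *: f + g) z = c * ev f z + ev g z,
      forall f g : E, (forall z, @unit_disc R z -> ev f z = ev g z) -> f = g
    & forall f : E, analytic_on (@unit_disc R) (ev f)].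

Definition coefficient (R : realType) (n : nat) (f : Cplx R -> Cplx R) :
    Cplx R :=
  derive1n n f 0 / n`!%:R.

(* The norm of a functional in the dual space, +oo if it is unbounded. *)
Definition dual_norm (R : realType) (E : normedModType (Cplx R))
    (phi : E -> Cplx R) : \bar R :=
  ereal_sup [set (rnorm (phi f))%:E | f in [set f : E | rnorm f <= 1]].

(* [B] maps [E] to itself and is the weighted backward shift: if the Taylor
   coefficients of [f] at 0 are l_n, then [B f] is the function
   z |-> \sum_n w_(n+1) l_(n+1) z^n on the disc. *)
Definition weighted_backward_shift (R : realType)
    (E : normedModType (Cplx R)) (ev : E -> Cplx R -> Cplx R)
    (w : nat -> Cplx R) (B : E -> E) : Prop :=
  forall (f : E) z, @unit_disc R z ->
    series (fun n => w n.+1 * coefficient n.+1 (ev f) * z ^+ n) @ \oo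
      --> ev (B f) z.

Definition hypercyclic (X : topologicalType) (T : X -> X) : Prop :=
  exists x : X, dense (range (fun n => iter n T x)).

Definition mixing (X : topologicalType) (T : X -> X) : Prop :=
  forall U1 U2 : set X, open U1 -> open U2 -> U1 !=set0 -> U2 !=set0 ->
    cofinite_set [set k : nat | (iter k T @` U1) `&` U2 !=set0].

(* Main.v *)
(* The number u_n = ||z^n|| / |w_1 ... w_n| is the norm of S^n 1, where
   S z^i = z^(i+1) / w_(i+1) is a right inverse of B on polynomials, and up to a
   constant it also bounds S^n z^i in terms of u_(n+i). If u is small at k, ...,
   k + deg q and k > deg p, then p + S^k q is close to p and B^k maps it exactly
   to q, which gives mixing when u tends to 0, and topological transitivity (hence
   hypercyclicity, by Birkhoff) when liminf u = 0, because u_n <= C u_(n+1) turns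
   one small value into a block of small values.
   Conversely k_0 (B^n f) = w_1 ... w_n k_n(f), so the bound on ||k_n|| ||z^n||
   gives |k_0 (B^n f)| u_n <= C ||f||, and both properties force the left factor
   to be large.
   Linearity of k_n rests on differentiating a complex power series termwise. *)
Require Import Defs.
From mathcomp Require Import all_boot all_order all_algebra.
From mathcomp Require Import complex ring lra.
From mathcomp Require Import all_classical all_reals all_analysis.

Set Implicit Arguments.
Unset Strict Implicit.
Unset Printing Implicit Defensive.

Import Order.TTheory GRing.Theory Num.Theory.
Import numFieldNormedType.Exports.
Local Open Scope classical_set_scope.
Local Open Scope ring_scope.

(** * Real-valued norms over complex scalars *)

Lemma normE (R : realType) (V : normedModType (Cplx R)) (x : V) :
  `|x| = (rnorm x)%:C%C :> Cplx R.
Proof.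
have := normr_ge0 x; rewrite /rnorm.
by case: `|x| => a b; rewrite lecE /= => /andP[/eqP -> _].
Qed.

Lemma rnorm_ge0 (R : realType) (V : normedModType (Cplx R)) (x : V) :
  0 <= rnorm x.
Proof. by rewrite -lecR -normE normr_ge0. Qed.

Lemma rnorm_eq0 (R : realType) (V : normedModType (Cplx R)) (x : V) :
  (rnorm x == 0) = (x == 0).
Proof.
rewrite -(normr_eq0 x) normE; apply/eqP/eqP => [->//|].
by move=> /complexI.
Qed.

Lemma rnorm0 (R : realType) (V : normedModType (Cplx R)) :
  rnorm (0 : V) = 0.
Proof. by apply/eqP; rewrite rnorm_eq0. Qed.

Lemma rnorm_gt0 (R : realType) (V : normedModType (Cplx R)) (x : V) :
  (0 < rnorm x) = (x != 0).
Proof. by rewrite lt_def rnorm_ge0 andbT rnorm_eq0. Qed.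

Lemma rnormD (R : realType) (V : normedModType (Cplx R)) (x y : V) :
  rnorm (x + y) <= rnorm x + rnorm y.
Proof. by rewrite -lecR rmorphD /= -!normE ler_normD. Qed.

Lemma rnormN (R : realType) (V : normedModType (Cplx R)) (x : V) :
  rnorm (- x) = rnorm x.
Proof. by rewrite /rnorm normrN. Qed.

Lemma rdistD (R : realType) (V : normedModType (Cplx R)) (z x y : V) :
  rnorm (x - y) <= rnorm (x - z) + rnorm (z - y).
Proof. by rewrite -[x - y](subrKA z) rnormD. Qed.

Lemma rnormZ (R : realType) (V : normedModType (Cplx R)) (c : Cplx R) (x : V) :
  rnorm (c *: x) = rnorm c * rnorm x.
Proof. by apply: complexI; rewrite rmorphM /= -!normE normrZ. Qed.

Lemma rnormM (R : realType) (c d : Cplx R) : rnorm (c * d) = rnorm c * rnorm d.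
Proof. exact: rnormZ. Qed.

Lemma rnorm1 (R : realType) : rnorm (1 : Cplx R) = 1.
Proof. by rewrite /rnorm normr1. Qed.

Lemma rnormX (R : realType) (c : Cplx R) n : rnorm (c ^+ n) = rnorm c ^+ n.
Proof. by elim: n => [|n ih]; rewrite ?rnorm1// !exprS rnormM ih. Qed.

Lemma rnormV (R : realType) (c : Cplx R) : rnorm c^-1 = (rnorm c)^-1.
Proof.
apply: complexI; rewrite -!normE normfV normE.
by rewrite [RHS](fmorphV (real_complex R)).
Qed.

Lemma rnorm_real (R : realType) (x : R) : rnorm (x%:C%C : Cplx R) = `|x|.
Proof. by rewrite /rnorm normc_def /= expr0n /= addr0 sqrtr_sqr. Qed.

Lemma rnorm_nat (R : realType) (n : nat) : rnorm (n%:R : Cplx R) = n%:R.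
Proof. by apply: complexI; rewrite -normE normr_nat rmorph_nat. Qed.

Lemma rnorm_sum (R : realType) (V : normedModType (Cplx R)) (u : nat -> V)
    (n : nat) : rnorm (\sum_(0 <= k < n) u k) <= \sum_(0 <= k < n) rnorm (u k).
Proof.
elim: n => [|n ih]; first by rewrite !big_geq// rnorm0.
rewrite !big_nat_recr//=; apply: le_trans (rnormD _ _) _.
exact: lerD.
Qed.

(** Balls a priori have radii in [Cplx R]; a positive complex number is real, so real radii describe
    the same neighbourhoods. *)
Lemma nbhs_rnormP (R : realType) (V : normedModType (Cplx R)) (x : V)
    (A : set V) :
  nbhs x A <-> exists2 e : R, 0 < e & forall y, rnorm (x - y) < e -> A y.
Proof.
split.
  move=> /nbhs_ballP[e /= e0 eA].
  have eE : e = (complex.Re e)%:C%C.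
    by move: e0; case: (e) => a b; rewrite ltcE /= => /andP[/eqP -> _].
  exists (complex.Re e); first by rewrite -ltcR -eE.
  by move=> y xy; apply: eA; rewrite -ball_normE /= normE eE ltcR.
case=> e e0 eA; apply/nbhs_ballP; exists (e%:C%C); first by rewrite /= ltcR.
by move=> y; rewrite -ball_normE /= normE ltcR => /eA.
Qed.

(** * Convergence in the real norm and complex series *)

Lemma cvg_rnormP (R : realType) (V : normedModType (Cplx R)) (T : Type)
    (F : set_system T) (FF : Filter F) (f : T -> V) (l : V) :
  f @ F --> l <->
  forall e : R, 0 < e -> \forall x \near F, rnorm (l - f x) < e.
Proof.
split=> [fl e e0|fl A /nbhs_rnormP[e e0 eA]].
  by apply: (fl [set y | rnorm (l - y) < e]); apply/nbhs_rnormP; exists e.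
by apply: filterS (fl _ e0) => x /eA.
Qed.

Lemma rnorm_lim_le (R : realType) (V : normedModType (Cplx R)) (u : nat -> V)
    (l : V) (C : R) :
  u @ \oo --> l -> (forall n, rnorm (u n) <= C) -> rnorm l <= C.
Proof.
move=> /cvg_rnormP ul uC; apply/ler_addgt0Pr => e e0.
have [n _ /(_ n (leqnn n)) /=] := ul e e0.
move=> ln; rewrite -[l](subrK (u n)); apply: le_trans (rnormD _ _) _.
by rewrite addrC lerD// ltW.
Qed.

Lemma cauchy_rnormP (R : realType) (V : completeNormedModType (Cplx R))
    (u : nat -> V) :
  (forall e : R, 0 < e -> exists N, forall n, (N <= n)%N ->
    rnorm (u N - u n) < e) -> cvgn u.
Proof.
move=> uC; apply: cauchy_cvg; apply: cauchy_exP => e e0.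
have [e' e'0 eE] : exists2 e' : R, 0 < e' & e = e'%:C%C.
  exists (complex.Re e); move: e0; case: (e) => a b; rewrite ltcE /=.
    by move=> /andP[].
  by move=> /andP[/eqP ->].
have [N uN] := uC _ e'0.
exists (u N); exists N => // n /= Nn.
by rewrite /= -ball_normE /= normE eE ltcR uN.
Qed.

(* [Cplx R] carries no complete-space instance, so limits of series are built
   from their real and imaginary parts. *)
Lemma cvg_series_dominated (R : realType) (c : nat -> Cplx R) (b : nat -> R) :
  (forall n, rnorm (c n) <= b n) -> cvgn (series b) -> cvgn (series c).
Proof.
move=> cb bcvg.
have part (p : Cplx R -> R) : (forall z, `|p z| <= rnorm z) ->
    cvgn (series (p \o c)).
  move=> pn; apply: normed_cvg; apply: series_le_cvg bcvg => n /=.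
  - exact: normr_ge0.
  - exact: le_trans (rnorm_ge0 _) (cb n).
  - exact: le_trans (pn _) (cb n).
have nRe (z : Cplx R) : `|complex.Re z| <= rnorm z.
  by rewrite -lecR -normE normc_ge_Re.
have nIm (z : Cplx R) : `|complex.Im z| <= rnorm z.
  rewrite /rnorm normc_def /= -sqrtr_sqr ler_sqrt ?addr_ge0 ?sqr_ge0//.
  by rewrite lerDr sqr_ge0.
have /cvg_ex[a /= /cvgrPdist_lt ha] := part _ nRe.
have /cvg_ex[d /= /cvgrPdist_lt hd] := part _ nIm.
suff : series c @ \oo --> ((a +i* d)%C : Cplx R) by exact: cvgP.
apply/cvg_rnormP => e e0.
have e20 : 0 < e / 2 by rewrite divr_gt0.
have sE n : series c n = (series (@complex.Re R \o c) n
                          +i* series (@complex.Im R \o c) n)%C.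
  rewrite /series /=; elim: n => [|n ih]; first by rewrite !big_geq.
  by rewrite !big_nat_recr//= ih; case: (c n).
near=> n.
have -> : ((a +i* d)%C - series c n : Cplx R) =
   ((a - series (@complex.Re R \o c) n)%:C +
    'i * (d - series (@complex.Im R \o c) n)%:C)%C.
  rewrite sE; apply/eqP; rewrite eq_complex /=.
  by apply/andP; split; apply/eqP; ring.
apply: le_lt_trans (rnormD _ _) _.
rewrite rnormM !rnorm_real.
have -> : rnorm ('i%C : Cplx R) = 1.
  by rewrite /rnorm normc_def /= expr0n /= add0r expr1n sqrtr1.
rewrite mul1r [e]splitr ltrD//.
  by near: n; exact: ha.
by near: n; exact: hd.
Unshelve. all: by end_near. Qed.

(** From some [N] on, each term is the difference of two remainders of norm below 1, which gives the
    2; the finite sum covers the earlier terms. *)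
Lemma cvg_series_terms_bounded (R : realType) (u : nat -> Cplx R) (l : Cplx R) :
  series u @ \oo --> l -> exists M : R, forall n, rnorm (u n) <= M.
Proof.
move=> /cvg_rnormP /(_ 1 ltr01)[N _ ul].
exists (2 + \sum_(0 <= k < N) rnorm (u k)) => n.
have s0 m : 0 <= \sum_(0 <= k < m) rnorm (u k).
  by apply: sumr_ge0 => i _; exact: rnorm_ge0.
have [Nn|nN] := leqP N n.
  have -> : u n = (l - series u n) - (l - series u n.+1).
    by rewrite /series /= big_nat_recr//=; ring.
  apply: le_trans (rnormD _ _) _; rewrite rnormN.
  have /= h1 := ltW (ul n Nn).
  have /= h2 := ltW (ul n.+1 (leqW Nn)).
  by have := s0 N; lra.
apply: (@le_trans _ _ (\sum_(0 <= k < N) rnorm (u k))); last by rewrite lerDr.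
rewrite (@big_cat_nat _ _ _ n.+1)//= big_nat_recr//=.
have : 0 <= \sum_(n.+1 <= k < N) rnorm (u k).
  by apply: sumr_ge0 => i _; exact: rnorm_ge0.
by have := s0 n; lra.
Qed.

(** * Termwise differentiation and Taylor coefficients *)

Lemma sum_half_pow_le (R : realType) n :
  \sum_(0 <= k < n) (2^-1 : R) ^+ k <= 2.
Proof.
suff -> : \sum_(0 <= k < n) (2^-1 : R) ^+ k = 2 - 2 * 2^-1 ^+ n.
  by have : 0 <= (2^-1 : R) ^+ n by []; lra.
elim: n => [|n ih]; first by rewrite big_geq// expr0; lra.
by rewrite big_nat_recr//= ih exprS; lra.
Qed.

(** The first-order remainder r_n satisfies r_(n+1) = (z + h) r_n + n h^2 z^(n-1), and n <= 2^n
    absorbs the linear factor. The price is the ratio 2s instead of s. *)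
Lemma expr_taylor1_le (R : realType) (z h : Cplx R) (s : R) n : 0 < s ->
  rnorm z <= s -> rnorm (z + h) <= s ->
  rnorm ((z + h) ^+ n - z ^+ n - n%:R * h * z ^+ n.-1)
    <= rnorm h ^+ 2 / s ^+ 2 * (2 * s) ^+ n.
Proof.
move=> s0 zs zhs.
elim: n => [|n ih].
  rewrite !expr0 subrr mul0r mul0r subr0 rnorm0.
  by rewrite mulr1 divr_ge0 ?exprn_ge0 ?rnorm_ge0// ltW.
have -> : (z + h) ^+ n.+1 - z ^+ n.+1 - n.+1%:R * h * z ^+ n.+1.-1 =
   (z + h) * ((z + h) ^+ n - z ^+ n - n%:R * h * z ^+ n.-1)
   + n%:R * h ^+ 2 * z ^+ n.-1.
  case: n {ih} => [|n]; first by rewrite !expr0 !expr1; ring.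
  by rewrite /= !exprS -(natr1 n.+1); ring.
apply: le_trans (rnormD _ _) _.
rewrite [rnorm ((z + h) * _)]rnormM (rnormM (n%:R * _)) (rnormM n%:R).
rewrite (rnormX h) (rnormX z) rnorm_nat.
have -> : rnorm h ^+ 2 / s ^+ 2 * (2 * s) ^+ n.+1 =
   s * (rnorm h ^+ 2 / s ^+ 2 * (2 * s) ^+ n)
   + rnorm h ^+ 2 / s ^+ 2 * (2 ^+ n * s ^+ n.+1).
  by rewrite !exprMn !exprS; ring.
apply: lerD.
  by apply: ler_pM => //; exact: rnorm_ge0.
have H0 : 0 <= rnorm h ^+ 2 by rewrite exprn_ge0// rnorm_ge0.
move: H0; move: (rnorm h ^+ 2) => H H0.
have -> : n%:R * H * rnorm z ^+ n.-1 = H * (n%:R * rnorm z ^+ n.-1) by ring.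
rewrite -mulrA; apply: ler_wpM2l => //.
rewrite [leRHS]mulrC ler_pdivlMr ?exprn_gt0//.
case: n {ih} => [|n].
  by rewrite mul0r mul0r mulr_ge0// exprn_ge0// ltW.
rewrite -mulrA /=.
have -> : 2 ^+ n.+1 * s ^+ n.+2 = 2 ^+ n.+1 * (s ^+ n * s ^+ 2).
  by rewrite -exprD addn2.
apply: ler_pM => //.
- by rewrite mulr_ge0 ?exprn_ge0// ?rnorm_ge0// ltW.
- by rewrite -natrX ler_nat ltnW// ltn_expl.
- by rewrite ler_pM2r ?exprn_gt0// lerXn2r ?nnegrE ?rnorm_ge0// ltW.
Qed.

(** Convergence at a radius [rho] below [r] gives |a_n| <= M / rho^n. On a much smaller disc the
    first-order remainders then sum to O(|h|^2), so the termwise derivative D is the derivative. *)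
Lemma cvg_pseries_derive1 (R : realType) (a : nat -> Cplx R)
    (f : Cplx R -> Cplx R) (r : R) : 0 < r ->
  (forall z : Cplx R, rnorm z < r -> series (fun n => a n * z ^+ n) @ \oo --> f z) ->
  exists2 r' : R, 0 < r' & forall z : Cplx R, rnorm z < r' ->
    series (fun n => n.+1%:R * a n.+1 * z ^+ n) @ \oo --> derive1 f z.
Proof.
(* With s = rho / 4, the product of M / rho^n and (2s)^n is geometric of ratio 1/2. Taking |z| and
   |h| below s / 2 keeps z and z + h within s. *)
move=> r0 fE; pose rho := r / 2; pose s := rho / 4.
have rho0 : 0 < rho by rewrite divr_gt0.
have s0 : 0 < s by rewrite divr_gt0.
have sr : s < r by rewrite /s /rho; lra.
have rhor : rho < r by rewrite /rho; lra.
have s2E : 2 * s = rho * 2^-1 by rewrite /s; field.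
clearbody s; clearbody rho.
have [M aM] : exists M : R, forall n, rnorm (a n) <= M / rho ^+ n.
  have rr : rnorm (rho%:C%C : Cplx R) < r.
    by rewrite rnorm_real gtr0_norm.
  have [M aM] := cvg_series_terms_bounded (fE _ rr).
  exists M => n; rewrite ler_pdivlMr ?exprn_gt0//.
  by move: (aM n); rewrite rnormM rnormX rnorm_real gtr0_norm.
have M0 : 0 <= M.
  by have := le_trans (rnorm_ge0 _) (aM 0%N); rewrite expr0 divr1.
exists (s / 2) => [|z zs]; first by rewrite divr_gt0.
have zs' : rnorm z <= s by lra.
set c := fun n => _ : Cplx R.
have /cvg_ex[D /= cD] : cvgn (series c).
  apply: (@cvg_series_dominated _ _ (geometric (M / rho) 2^-1)); last first.
    by apply: is_cvg_geometric_series; rewrite ger0_norm ?invr_ge0//; lra.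
  move=> n /=; rewrite /c !rnormM rnormX rnorm_nat.
  apply: (@le_trans _ _ (2 ^+ n * (M / rho ^+ n.+1) * s ^+ n)); last first.
    rewrite le_eqVlt; apply/orP; left; apply/eqP.
    have -> : 2 ^+ n * (M / rho ^+ n.+1) * s ^+ n =
       M / rho ^+ n.+1 * (2 * s) ^+ n by rewrite mulrAC mulrC exprMn.
    rewrite s2E exprMn exprS.
    have : rho ^+ n != 0 by rewrite expf_neq0// gt_eqF.
    move: (rho ^+ n) => X X0.
    by field; rewrite X0 gt_eqF.
  apply: ler_pM.
  - by rewrite mulr_ge0// rnorm_ge0.
  - by rewrite exprn_ge0// rnorm_ge0.
  - apply: ler_pM => //; first exact: rnorm_ge0.
    by rewrite -natrX ler_nat ltn_expl.
  - by rewrite lerXn2r ?nnegrE ?rnorm_ge0// ltW.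
suff -> : derive1 f z = D by [].
(* Reindexed with a vanishing 0-th term, the derived series lines up with the linear terms of the
   Taylor remainders. *)
have tail : (fun N => \sum_(0 <= n < N) n%:R * a n * z ^+ n.-1) @ \oo --> D.
  rewrite -cvg_shiftS; apply: cvg_trans cD; apply: near_eq_cvg.
  near=> N; rewrite /series /= big_nat_recl//= mul0r mul0r add0r.
  by [].
pose K := 2 * M / s ^+ 2.
have K0 : 0 <= K by rewrite divr_ge0 ?exprn_ge0 ?mulr_ge0// ltW.
have key (h : Cplx R) : rnorm h < s / 2 ->
    rnorm (f (h + z) - f z - h * D) <= K * rnorm h ^+ 2.
  move=> hs.
  have zhs : rnorm (z + h) <= s by apply: le_trans (rnormD _ _) _; lra.
  have cv : (fun N => \sum_(0 <= n < N) a n *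
       ((z + h) ^+ n - z ^+ n - n%:R * h * z ^+ n.-1)) @ \oo -->
       f (h + z) - f z - h * D.
    have -> : (fun N => \sum_(0 <= n < N) a n *
       ((z + h) ^+ n - z ^+ n - n%:R * h * z ^+ n.-1)) =
      (fun N => series (fun n => a n * (h + z) ^+ n) N -
                series (fun n => a n * z ^+ n) N -
                h * \sum_(0 <= n < N) n%:R * a n * z ^+ n.-1).
      apply/funext => N; rewrite /series /= mulr_sumr -!sumrB.
      by apply: eq_bigr => n _; rewrite (addrC h); ring.
    apply: cvgB; first apply: cvgB.
    - by apply: fE; rewrite addrC; exact: le_lt_trans zhs sr.
    - by apply: fE; exact: le_lt_trans zs' sr.
    - by apply: cvgMr.
  apply: rnorm_lim_le cv _ => N.
  apply: le_trans (rnorm_sum _ _) _.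
  apply: (@le_trans _ _ (\sum_(0 <= n < N)
     (M * rnorm h ^+ 2 / s ^+ 2) * 2^-1 ^+ n)).
    apply: ler_sum => n _; rewrite rnormM.
    apply: (@le_trans _ _ (M / rho ^+ n *
       (rnorm h ^+ 2 / s ^+ 2 * (2 * s) ^+ n))).
      by apply: ler_pM; rewrite ?rnorm_ge0//; exact: expr_taylor1_le.
    rewrite s2E exprMn le_eqVlt; apply/orP; left; apply/eqP.
    have : s ^+ 2 != 0 by rewrite expf_neq0// gt_eqF.
    have : rho ^+ n != 0 by rewrite expf_neq0// gt_eqF.
    move: (rho ^+ n) (s ^+ 2) => X Y X0 Y0.
    by field; rewrite X0 Y0.
  rewrite -mulr_sumr.
  have -> : K * rnorm h ^+ 2 = (M * rnorm h ^+ 2 / s ^+ 2) * 2.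
    by rewrite /K; ring.
  apply: ler_wpM2l (sum_half_pow_le _ _).
  by rewrite divr_ge0 ?mulr_ge0 ?exprn_ge0 ?rnorm_ge0// ltW.
rewrite /derive1; apply: cvg_lim => //.
apply/cvg_rnormP => e e0; rewrite near_withinE.
(* Dividing by K + 1 rather than K allows K = 0. *)
apply/nbhs_rnormP; exists (Num.min (s / 2) (e / (K + 1))).
  by rewrite lt_min !divr_gt0// ltr_wpDl.
move=> h; rewrite sub0r rnormN lt_min => /andP[hs he] h0.
have -> : D - h^-1 *: (f (h + z) - f z) =
    - (h^-1 * (f (h + z) - f z - h * D)).
  rewrite -[_ *: _]/(_ * _) [in RHS]mulrBr mulrA mulVf//; ring.
rewrite rnormN rnormM rnormV.
have h0' : 0 < rnorm h by rewrite rnorm_gt0.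
rewrite mulrC ltr_pdivrMr//; apply: le_lt_trans (key h hs) _.
rewrite expr2 mulrA ltr_pM2r//.
move: he; rewrite ltr_pdivlMr ?ltr_wpDl//; lra.
Unshelve. all: by end_near. Qed.

(** Differentiation turns a_n into (n+1) a_(n+1), possibly on a smaller disc, so the induction
    generalizes the series, the function and the radius. Later identities between coefficients
    follow by exhibiting a power series. *)
Lemma coefficient_pseries (R : realType) (a : nat -> Cplx R)
    (f : Cplx R -> Cplx R) (n : nat) :
  (\forall z \near (0 : Cplx R), series (fun n => a n * z ^+ n) @ \oo --> f z) ->
  coefficient n f = a n.
Proof.
move=> /nbhs_rnormP[r r0 fE].
have {}fE (z : Cplx R) : rnorm z < r ->
    series (fun n => a n * z ^+ n) @ \oo --> f z.
  by move=> zr; apply: fE; rewrite sub0r rnormN.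
suff h : derive1n n f 0 = n`!%:R * a n.
  by rewrite /coefficient h mulrC mulKf// pnatr_eq0 -lt0n fact_gt0.
elim: n a f r r0 fE => [|n ih] a f r r0 fE.
  rewrite derive1n0 fact0 mul1r.
  have /cvg_lim <- // : series (fun n => a n * 0 ^+ n) @ \oo --> f 0.
    by apply: fE; rewrite rnorm0.
  apply: lim_near_cst => //.
  exists 1%N => // -[//|m] _; rewrite /series /= big_nat_recl//= expr0 mulr1.
  by rewrite big1 ?addr0// => i _; rewrite expr0n mulr0.
have [r' r'0 dfE] := cvg_pseries_derive1 r0 fE.
by rewrite derive1Sn (ih _ _ _ r'0 dfE) factS natrM; ring.
Qed.

(** * Transitivity implies hypercyclicity *)

Lemma open_rball (R : realType) (V : normedModType (Cplx R)) (x : V) (e : R) :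
  open [set y | rnorm (x - y) < e].
Proof.
rewrite openE => y /= xy; apply/nbhs_rnormP.
exists (e - rnorm (x - y)); first by rewrite subr_gt0.
move=> z; rewrite ltrBrDl; apply: le_lt_trans.
exact: rdistD.
Qed.

Lemma rball_nonempty (R : realType) (V : normedModType (Cplx R)) (x : V)
    (e : R) : 0 < e -> [set y | rnorm (x - y) < e] !=set0.
Proof. by move=> e0; exists x; rewrite /= subrr rnorm0. Qed.

Lemma continuous_iter (T : topologicalType) (f : T -> T) (k : nat) :
  continuous f -> continuous (iter k f).
Proof.
move=> cf; elim: k => [|k ih] x; first exact: cvg_id.
exact: (@continuous_comp _ _ _ (iter k f) f x (ih x) (cf _)).
Qed.

Definition topologically_transitive (X : topologicalType) (T : X -> X) : Prop :=
  forall U V : set X, open U -> open V -> U !=set0 -> V !=set0 ->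
    exists k x, U x /\ V (iter k T x).

(* Birkhoff's transitivity theorem. [Baire] is only available over a real field
   of scalars, so the nested balls are built by hand. *)
Lemma transitive_hypercyclic (R : realType)
    (E : completeNormedModType (Cplx R)) (T : E -> E) :
  separable_space E -> continuous T -> topologically_transitive T -> hypercyclic T.
Proof.
move=> [A [/pcard_injP[num numI] Adense]] cT trT.
(* The pairs ([c j], [rho j]) run through all balls with centre in [A] and radius 1/(m+1); codes
   that name no such ball get harmless defaults. *)
pose y i := xget 0 [set x | A x /\ num x = i].
pose c j := if @unpickle (nat * nat)%type j is Some (i, m) then y i else 0.
pose rho j : R :=
  if @unpickle (nat * nat)%type j is Some (i, m) then m.+1%:R^-1 else 1.
have rho0 j : 0 < rho j by rewrite /rho; case: (unpickle j) => [[i m]|].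
(* One stage of the construction: inside the ball (x, e), a ball of at most half the radius whose
   closure some iterate sends into the j-th target ball. Guarding by e > 0 makes the relation total,
   as [choice] requires. *)
pose P (jxe : nat * (E * R)) (xe' : E * R) := 0 < jxe.2.2 ->
  [/\ 0 < xe'.2, xe'.2 <= jxe.2.2 / 2,
      rnorm (jxe.2.1 - xe'.1) + xe'.2 <= jxe.2.2 &
      exists k, forall z, rnorm (xe'.1 - z) <= xe'.2 ->
        rnorm (c jxe.1 - iter k T z) < rho jxe.1].
have /choice[F FP] : forall jxe, exists xe', P jxe xe'.
  move=> [j [x e]]; rewrite /P /=.
  have [e0|e0] := ltP 0 e; last by exists (0, 0).
  have [k [x' [/= xx' ckx']]] := trT _ _ (@open_rball _ _ x e)
    (@open_rball _ _ (c j) (rho j))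
    (rball_nonempty x e0) (rball_nonempty (c j) (rho0 j)).
  have /nbhs_rnormP[d d0 dV] : nbhs x'
      (iter k T @^-1` [set z | rnorm (c j - z) < rho j]).
    apply: (continuous_iter cT).
    by apply: open_nbhs_nbhs; split => //; exact: open_rball.
  (* The three bounds give halving, a closed ball inside the open [d]-ball, and nesting. *)
  exists (x', Num.min (e / 2) (Num.min (d / 2) (e - rnorm (x - x')))) => _ /=.
  split.
  - by rewrite !lt_min !divr_gt0//= subr_gt0.
  - by rewrite ge_min lexx.
  - have : Num.min (e / 2) (Num.min (d / 2) (e - rnorm (x - x'))) <=
        e - rnorm (x - x').
      by rewrite !ge_min lexx !orbT.
    by rewrite lerBrDl.
  - exists k => z; rewrite !le_min => /and3P[_ zd _].
    by apply: dV; lra.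
pose s := fix s n : E * R := if n is n'.+1 then F (n', s n') else (0, 1).
have s0 n : 0 < (s n).2.
  by elim: n => [//|n ih] /=; have [] := FP (n, s n) ih.
have sS n := FP (n, s n) (s0 n).
have shalf n : (s n).2 <= 2^-1 ^+ n.
  elim: n => [//|n ih]; have [_ h _ _] := sS n.
  by rewrite exprS; move: h => /=; lra.
(* Nesting in the form distance plus radius, which adds up along the stages by the triangle
   inequality. *)
have nest n m : rnorm ((s n).1 - (s (n + m)%N).1) + (s (n + m)%N).2 <= (s n).2.
  elim: m => [|m ih]; first by rewrite addn0 subrr rnorm0 add0r.
  have [_ _ h _] := sS (n + m)%N.
  rewrite addnS; apply: le_trans ih => /=.
  apply: le_trans (lerD (rdistD (s (n + m)%N).1 _ _) (lexx _)) _.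
  by rewrite -addrA lerD2l.
have /cvg_ex[l /= sl] : cvgn (fun n => (s n).1).
  apply: cauchy_rnormP => e e0.
  have [N Ne] : exists N, (2^-1 : R) ^+ N < e.
    have half1 : `|2^-1 : R| < 1 by rewrite ger0_norm ?invr_ge0//; lra.
    have /cvgrPdist_lt /(_ e e0)[N _ /(_ N (leqnn N))] :=
      cvg_geometric 1 half1.
    rewrite sub0r normrN /geometric /= mul1r ger0_norm ?exprn_ge0// => Ne.
    by exists N.
  exists N => n Nn; rewrite -(subnKC Nn).
  by have := nest N (n - N)%N; have := shalf N; have := s0 (N + (n - N))%N; lra.
have lball n : rnorm ((s n).1 - l) <= (s n).2.
  apply: (@rnorm_lim_le _ _ (fun m => (s n).1 - (s (m + n)%N).1)).
    apply: cvgB; first exact: cvg_cst.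
    by rewrite (@cvg_shiftn n _ (fun n => (s n).1)).
  by move=> m; rewrite addnC; have := nest n m; have := s0 (n + m)%N; lra.
exists l => O [p Op] Oopen.
have /nbhs_rnormP[e e0 eO] : nbhs p O by apply: open_nbhs_nbhs.
have e20 : 0 < e / 2 by rewrite divr_gt0.
have [a [/= pa Aa]] := Adense _ (rball_nonempty p e20)
  (@open_rball _ _ p (e / 2)).
(* Chosen so that 1/(m+1) < e/2: the target ball around [a] then lies in the [e]-ball around [p]. *)
pose m := Num.truncn (e / 2)^-1.
pose j := pickle (num a, m).
have cj : c j = a.
  rewrite /c /j pickleK /y; case: xgetP => [b _ [Ab ba]|/(_ a)[]//].
  by apply: numI; rewrite ?inE.
have [_ _ _ [k kP]] := sS j.
exists (iter k T l); split; last by exists k.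
apply: eO; have /= := kP l (lball j.+1); rewrite cj => h.
have : rho j < e / 2.
  rewrite /rho /j pickleK -[ltRHS]invrK ltf_pV2 ?posrE ?invr_gt0//.
  exact: truncnS_gt.
move=> hr; apply: le_lt_trans (rdistD a _ _) _; lra.
Qed.

(** * The disc, polynomials as power series, and the lower limit *)

Lemma unit_discE (R : realType) (z : Cplx R) : unit_disc z <-> rnorm z < 1.
Proof. by rewrite /unit_disc /= normE -ltcR. Qed.

Lemma near0_unit_disc (R : realType) :
  \forall z \near (0 : Cplx R), unit_disc z.
Proof.
by apply/nbhs_rnormP; exists 1 => // z; rewrite sub0r rnormN => /unit_discE.
Qed.

Lemma cvg_series_horner (R : realType) (p : {poly Cplx R}) (z : Cplx R) :
  series (fun n => p`_n * z ^+ n) @ \oo --> p.[z].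
Proof.
apply: cvg_near_cst; exists (size p) => // m /= pm.
rewrite /series /= horner_coef -(big_mkord xpredT (fun i => p`_i * z ^+ i)).
rewrite (@big_cat_nat _ _ _ (size p))//= [X in _ + X]big1_seq ?addr0//.
move=> i /andP[_]; rewrite mem_index_iota => /andP[pi _].
by rewrite nth_default// mul0r.
Qed.

(** The tail infima are nonnegative and nondecreasing, so their limit is 0 exactly when each of them
    is 0. *)
Lemma limn_einf_eq0P (R : realType) (u : nat -> R) : (forall n, 0 <= u n) ->
  limn_einf (fun n => (u n)%:E) = 0%E <->
  forall (e : R) N, 0 < e -> exists2 n, (N <= n)%N & u n < e.
Proof.
move=> u0; rewrite limn_einf_lim.
have inf0 N : (0 <= einfs (fun n => (u n)%:E) N)%E.
  by apply: le_ereal_inf_tmp => _ [n /= _ <-]; rewrite lee_fin.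
split=> [lim0 e N e0|uE].
  have : (einfs (fun n => (u n)%:E) N < e%:E)%E.
    apply: (@le_lt_trans _ _ 0%E); last by rewrite lte_fin.
    rewrite -lim0; have /cvg_lim -> // := ereal_nondecreasing_cvgn
      (nondecreasing_einfs (fun n => (u n)%:E)).
    by apply: ereal_sup_ubound; exists N.
  by move=> /ereal_inf_lt[_ [n /= Nn <-]]; rewrite lte_fin; exists n.
have -> : einfs (fun n => (u n)%:E) = (fun _ => 0%E); last exact: lim_cst.
apply/funext => N; apply/eqP; rewrite eq_le inf0 andbT.
apply/lee_addgt0Pr => e e0; rewrite add0e.
have [n Nn une] := uE e N e0.
apply: (@le_trans _ _ (u n)%:E); last by rewrite lee_fin ltW.
by apply: ereal_inf_lbound; exists n.
Qed.

(** * Coefficient functionals and the shift on polynomials *)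

Section weighted_shift.
Context (R : realType) (E : completeNormedModType (Cplx R))
  (ev : E -> Cplx R -> Cplx R) (pol : {poly Cplx R} -> E)
  (w : nat -> Cplx R) (B : E -> E).
Hypotheses (hE : analytic_function_space ev)
  (hpol : forall p z, @unit_disc R z -> ev (pol p) z = p.[z])
  (hdense : dense (range pol))
  (hcoef : (ereal_sup (range (fun n : nat =>
        dual_norm (fun f : E => coefficient n (ev f)) *
        (rnorm (pol 'X^n))%:E)) < +oo)%E)
  (hw : forall n : nat, (0 < n)%N -> w n != 0)
  (hB : weighted_backward_shift ev w B)
  (hBcont : continuous B).

Local Notation kf n f := (coefficient n (ev f)).
Local Notation W n := (\prod_(1 <= i < n.+1) w i).
Let u n : R := 1 / rnorm (W n) * rnorm (pol 'X^n).

(** Analyticity supplies some power series at 0, and [coefficient_pseries] identifies its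
    coefficients. *)
Lemma ev_pseries (f : E) :
  \forall z \near (0 : Cplx R), series (fun n => kf n f * z ^+ n) @ \oo --> ev f z.
Proof.
have [_ _ /(_ f 0)[|a fa]] := hE; first by apply/unit_discE; rewrite rnorm0.
have {}fa : \forall z \near (0 : Cplx R),
    series (fun n => a n * z ^+ n) @ \oo --> ev f z.
  by apply: filterS fa => z; rewrite subr0.
have aE n := coefficient_pseries n fa.
by apply: filterS fa => z; under [X in _ -> series X @ _ --> _]eq_fun do rewrite aE.
Qed.

Lemma coefficient_linear n (c : Cplx R) (f g : E) :
  kf n (c *: f + g) = c * kf n f + kf n g.
Proof.
have [ev_lin _ _] := hE.
apply: (@coefficient_pseries _ (fun n => c * kf n f + kf n g)).
apply: filterS3 (near0_unit_disc R) (ev_pseries f) (ev_pseries g).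
move=> z z1 fz gz; rewrite (ev_lin z z1 c f g).
have -> : series (fun n => (c * kf n f + kf n g) * z ^+ n) =
    (fun N => c * series (fun n => kf n f * z ^+ n) N +
              series (fun n => kf n g * z ^+ n) N).
  apply/funext => N; rewrite /series /= mulr_sumr -big_split /=.
  by apply: eq_bigr => i _; ring.
by apply: cvgD gz; apply: cvgMr.
Qed.

Lemma coefficient_pol n p : kf n (pol p) = p`_n.
Proof.
apply: coefficient_pseries; apply: filterS (near0_unit_disc R) => z z1.
by rewrite hpol//; exact: cvg_series_horner.
Qed.

Lemma coefficient_shift n f : kf n (B f) = w n.+1 * kf n.+1 f.
Proof.
apply: (@coefficient_pseries _ (fun n => w n.+1 * kf n.+1 f)).
by apply: filterS (near0_unit_disc R) => z z1; exact: hB.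
Qed.

(** [pol] is given only through values on the disc, so its linearity comes from the injectivity of
    [ev]. *)
Lemma pol_linear (c : Cplx R) p q : pol (c *: p + q) = c *: pol p + pol q.
Proof.
have [ev_lin ev_inj _] := hE; apply: ev_inj => z z1.
by rewrite ev_lin// !hpol// hornerD hornerZ.
Qed.

Lemma pol0 : pol 0 = 0.
Proof.
have := pol_linear (-1) 0 0.
by rewrite scaler0 addr0 scaleN1r addNr.
Qed.

Lemma polD p q : pol (p + q) = pol p + pol q.
Proof. by have := pol_linear 1 p q; rewrite !scale1r. Qed.

Lemma polZ c p : pol (c *: p) = c *: pol p.
Proof. by have := pol_linear c p 0; rewrite !addr0 pol0 addr0. Qed.

Lemma pol_sum n (F : nat -> {poly Cplx R}) :
  pol (\sum_(0 <= i < n) F i) = \sum_(0 <= i < n) pol (F i).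
Proof.
elim: n => [|n ih]; first by rewrite !big_geq// pol0.
by rewrite !big_nat_recr//= polD ih.
Qed.

(** Both sides evaluate to the sum of the same finite series at each point of the disc. *)
Lemma shift_pol (p q : {poly Cplx R}) :
  (forall i, q`_i = w i.+1 * p`_i.+1) -> B (pol p) = pol q.
Proof.
move=> qE; have [_ ev_inj _] := hE; apply: ev_inj => z z1; rewrite hpol//.
have := @hB (pol p) z z1.
under eq_fun do rewrite coefficient_pol -qE.
by move=> /cvg_lim <- //; apply: cvg_lim => //; exact: cvg_series_horner.
Qed.

Lemma weightS n : W n.+1 = W n * w n.+1.
Proof. by rewrite big_nat_recr. Qed.

Lemma weight_neq0 n : W n != 0.
Proof.
elim: n => [|n ih]; first by rewrite big_geq// oner_neq0.
by rewrite weightS mulf_neq0// hw.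
Qed.

Lemma iter_shift_pol k (p q : {poly Cplx R}) :
  (forall i, q`_i = W (i + k)%N / W i * p`_(i + k)) -> iter k B (pol p) = pol q.
Proof.
elim: k q => [|k ih] q qE /=.
  congr pol; apply/polyP => i.
  by rewrite qE addn0 divff ?mul1r// weight_neq0.
(* The bound [size p] loses nothing: the coefficients of [p] beyond it vanish. *)
pose q' := \poly_(i < size p) (W (i + k)%N / W i * p`_(i + k)).
have q'E i : q'`_i = W (i + k)%N / W i * p`_(i + k).
  rewrite coef_poly; case: ltnP => // pi.
  by rewrite [p`_(i + k)]nth_default ?mulr0// (leq_trans pi)// leq_addr.
rewrite (ih q' q'E); apply: shift_pol => i.
rewrite qE q'E addSnnS (weightS i).
have := weight_neq0 i; have := hw (ltn0Sn i).
by move: (W i) (w i.+1) => x y y0 x0; field; rewrite x0 y0.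
Qed.

(** In the coordinates [W m * kf m] the operator becomes the unweighted shift, so iteration only
    moves the index. *)
Lemma weight_coefficient_iter n m f :
  W m * kf m (iter n B f) = W (m + n) * kf (m + n) f.
Proof.
elim: n m => [|n ih] m /=; first by rewrite addn0.
by rewrite coefficient_shift mulrA -weightS ih addSnnS.
Qed.

(** * The criterion sequence and the transitivity construction *)

Lemma monomial_neq0 n : pol 'X^n != 0.
Proof.
apply/eqP => Xn0; have := coefficient_pol n 'X^n; rewrite Xn0 -pol0 coefficient_pol.
by rewrite coef0 coefXn eqxx => /eqP; rewrite eq_sym oner_eq0.
Qed.

Lemma criterion_gt0 n : 0 < u n.
Proof.
by rewrite /u div1r mulr_gt0 ?invr_gt0 ?rnorm_gt0 ?weight_neq0 ?monomial_neq0.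
Qed.

(* Continuity of [B] at [0], tested on the monomial [z^(n+1)], which [B] maps to
   [w_(n+1) z^n]. *)
Lemma criterion_le_succ : exists2 C : R, 1 <= C & forall n, u n <= C * u n.+1.
Proof.
have B0 : B 0 = 0.
  rewrite -pol0; apply: shift_pol => i; by rewrite !coef0 mulr0.
have /nbhs_rnormP[d d0 Bd] : nbhs (0 : E) (B @^-1` [set y | rnorm (B 0 - y) < 1]).
  apply: hBcont; apply: open_nbhs_nbhs; split; first exact: open_rball.
  by rewrite /= subrr rnorm0.
(* The maximum with 1 makes the powers of the constant nondecreasing, which the block argument
   needs. *)
exists (Num.max 1 (2 / d)) => [|n]; first by rewrite le_max lexx.
suff : u n <= 2 / d * u n.+1.
  move=> /le_trans; apply; rewrite ler_pM2r ?criterion_gt0//.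
  by rewrite le_max lexx orbT.
(* Scales z^(n+1) to norm d/2, inside the ball that [B] maps into the unit ball. *)
pose t := d / 2 / rnorm (pol 'X^(n.+1)).
have X0 : 0 < rnorm (pol 'X^(n.+1)) by rewrite rnorm_gt0 monomial_neq0.
have t0 : 0 < t by rewrite !divr_gt0.
have : rnorm (B (pol ((t%:C%C : Cplx R) *: 'X^(n.+1)))) < 1.
  rewrite -[ltLHS]rnormN -sub0r -[0 in ltLHS]B0; apply: Bd.
  rewrite sub0r rnormN polZ rnormZ rnorm_real gtr0_norm// /t.
  by rewrite divfK ?gt_eqF//; lra.
rewrite (@shift_pol _ ((t%:C%C * w n.+1 : Cplx R) *: 'X^n)); last first.
  move=> i; rewrite !coefZ !coefXn eqSS; case: eqP => [->|_]; rewrite ?mulr1 ?mulr0//.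
  by rewrite mulrC.
rewrite polZ rnormZ rnormM rnorm_real gtr0_norm// => h.
rewrite /u weightS rnormM.
have W0 : 0 < rnorm (W n) by rewrite rnorm_gt0 weight_neq0.
have w0 : 0 < rnorm (w n.+1) by rewrite rnorm_gt0 hw.
rewrite !div1r invfM [leRHS]mulrC -!mulrA ler_pM2l ?invr_gt0//.
rewrite ler_pdivlMl//.
move: h; rewrite /t; move: (rnorm (pol 'X^(n.+1))) X0 => X X0.
move: (rnorm (w n.+1)) (rnorm (pol 'X^n)) => a b.
have -> : d / 2 / X * a * b = a * b / (2 / d * X).
  by field; rewrite !gt_eqF.
have dX : 0 < 2 / d * X by rewrite mulr_gt0 ?divr_gt0.
rewrite (ltr_pdivrMr _ _ dX) mul1r => /ltW.
by rewrite [X * _]mulrC.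
Qed.

Lemma criterion_le_add :
  exists2 C : R, 1 <= C & forall m n, u n <= C ^+ m * u (n + m)%N.
Proof.
have [C C1 uC] := criterion_le_succ; exists C => // m n.
have C0 : 0 < C by exact: lt_le_trans ltr01 C1.
elim: m => [|m ih]; first by rewrite expr0 mul1r addn0.
apply: le_trans ih _; rewrite exprSr -mulrA addnS.
by rewrite ler_pM2l ?exprn_gt0.
Qed.

(* The k-th iterate of [z^n |-> z^(n+1) / w_(n+1)], a right inverse of the
   shift on polynomials. *)
Definition right_inverse_poly k (q : {poly Cplx R}) : {poly Cplx R} :=
  \sum_(0 <= i < size q) (q`_i * W i / W (i + k)%N) *: 'X^(i + k).

Lemma coef_right_inverse_poly k (q : {poly Cplx R}) i :
  (right_inverse_poly k q)`_(i + k) = q`_i * W i / W (i + k)%N.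
Proof.
rewrite /right_inverse_poly big_mkord coef_sum.
pose c i := q`_i * W i / W (i + k)%N; rewrite -/(c i).
under eq_bigr => j _ do rewrite coefZ coefXn eqn_add2r -/(c j).
have [qi|iq] := leqP (size q) i.
  rewrite /c [q`_i]nth_default// !mul0r big1// => j _.
  by rewrite gtn_eqF ?mulr0// (leq_trans (ltn_ord j)).
rewrite (bigD1 (Ordinal iq))//= eqxx mulr1 big1 ?addr0// => j.
by rewrite -val_eqE /= eq_sym => /negPf ->; rewrite mulr0.
Qed.

(** The k-th iterate annihilates [p], whose degree is below k, and undoes the right inverse on
    [q]. *)
Lemma iter_shift_add_right_inverse k (p q : {poly Cplx R}) :
  (size p <= k)%N -> iter k B (pol (p + right_inverse_poly k q)) = pol q.
Proof.
move=> pk; apply: iter_shift_pol => i.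
rewrite coefD [p`__]nth_default ?add0r; last by rewrite (leq_trans pk) ?leq_addl.
rewrite coef_right_inverse_poly.
have := weight_neq0 i; have := weight_neq0 (i + k).
by move: (W i) (W (i + k)%N) => x y y0 x0; field; rewrite x0 y0.
Qed.

Lemma rnorm_right_inverse_le k (q : {poly Cplx R}) :
  rnorm (pol (right_inverse_poly k q)) <=
  \sum_(0 <= i < size q) rnorm (q`_i * W i) * u (i + k)%N.
Proof.
rewrite pol_sum; apply: le_trans (rnorm_sum _ _) _.
apply: ler_sum => i _; rewrite polZ rnormZ rnormM rnormV.
by rewrite /u div1r mulrA.
Qed.

Lemma open_pol (U : set E) : open U -> U !=set0 ->
  exists p (e : R), 0 < e /\ forall y, rnorm (pol p - y) < e -> U y.
Proof.
move=> Uo U0; have [x [Ux [p _ px]]] := hdense U0 Uo.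
have /nbhs_rnormP[e e0 eU] : nbhs (pol p) U.
  by rewrite px; exact: open_nbhs_nbhs.
by exists p, e.
Qed.

(** The common core of both sufficiency proofs. The witness is p + S^k q with [p] in [U] and [q] in
    [V]; [e] and [N] depend only on [U] and [V], so any late block of small values of [u] will
    do. *)
Lemma iter_shift_meets (U V : set E) : open U -> open V ->
    U !=set0 -> V !=set0 ->
  exists (e : R) N, 0 < e /\ forall k, (N <= k)%N ->
    (forall i, (i < N)%N -> u (i + k)%N < e) ->
    exists x, U x /\ V (iter k B x).
Proof.
move=> Uo Vo /(open_pol Uo)[p [e [e0 eU]]] /(open_pol Vo)[q [d [d0 dV]]].
pose S := \sum_(0 <= i < size q) rnorm (q`_i * W i).
have S0 : 0 <= S by apply: sumr_ge0 => i _; exact: rnorm_ge0.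
have S1 : 0 < S + 1 by rewrite ltr_wpDl.
(* [N] exceeds the degrees of both polynomials; S + 1 stays positive even for q = 0. *)
exists (e / (S + 1)), (maxn (size p) (size q)); split; first by rewrite divr_gt0.
move=> k; rewrite geq_max => /andP[pk qk] uk.
exists (pol (p + right_inverse_poly k q)); split; last first.
  by rewrite iter_shift_add_right_inverse//; apply: dV; rewrite subrr rnorm0.
apply: eU; rewrite polD opprD addNKr rnormN.
apply: le_lt_trans (rnorm_right_inverse_le _ _) _.
apply: (@le_lt_trans _ _ (S * (e / (S + 1)))).
  rewrite /S mulr_suml; apply: ler_sum_nat => i /andP[_ iq].
  apply: ler_wpM2l; first exact: rnorm_ge0.
  by apply/ltW/uk; rewrite (leq_trans iq)// leq_maxr.
rewrite mulrA ltr_pdivrMr// mulrC ltr_pM2l//; lra.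
Qed.

(** * Consequences of the bound on the coefficient functionals *)

(** The dual norm tests only the unit ball; normalizing [f] by its norm extends the bound to all
    vectors. *)
Lemma coefficient_bound : exists2 C : R, 0 <= C & forall n f,
  rnorm (kf n f) * rnorm (pol 'X^n) <= C * rnorm f.
Proof.
have [C C0 supC] : exists2 C : R, 0 <= C &
    (ereal_sup (range (fun n : nat =>
        dual_norm (fun f : E => kf n f) * (rnorm (pol 'X^n))%:E)) <= C%:E)%E.
  (* Finiteness from above leaves a real supremum or -oo; in the latter case 0 is a bound. *)
  move: hcoef; case: (ereal_sup _) => [c _|//|_].
    by exists `|c|; rewrite ?normr_ge0// lee_fin ler_norm.
  by exists 0; rewrite ?leNye.
exists C => // n f.
have unit_le g : rnorm g <= 1 -> rnorm (kf n g) * rnorm (pol 'X^n) <= C.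
  move=> g1; rewrite -lee_fin; apply: le_trans supC.
  apply: le_trans (ereal_sup_ubound _); last by exists n.
  rewrite EFinM; apply: lee_wpmul2r; first by rewrite lee_fin rnorm_ge0.
  by apply: ereal_sup_ubound; exists g.
have kf0 : kf n 0 = 0 by rewrite -pol0 coefficient_pol coef0.
have kfZ (c : Cplx R) g : kf n (c *: g) = c * kf n g.
  by rewrite -[c *: g]addr0 coefficient_linear kf0 addr0.
have [->|f0] := eqVneq f 0; first by rewrite kf0 !rnorm0 mul0r mulr0.
have nf0 : 0 < rnorm f by rewrite rnorm_gt0.
have := unit_le (((rnorm f)^-1)%:C%C *: f).
rewrite kfZ rnormZ rnormM rnorm_real gtr0_norm ?invr_gt0//.
rewrite mulVf ?gt_eqF// => /(_ (lexx _)).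
by rewrite -mulrA ler_pdivrMl// [leRHS]mulrC.
Qed.

(** The 0-th coefficient of B^n f is W_n k_n(f), and the factor 1 / |W_n| in [u n] cancels the
    weights. *)
Lemma iter_shift_coefficient0_bound : exists2 C : R, 0 <= C & forall n f,
  rnorm (kf 0 (iter n B f)) * u n <= C * rnorm f.
Proof.
have [C C0 kC] := coefficient_bound; exists C => // n f.
have := weight_coefficient_iter n 0 f; rewrite big_geq// mul1r add0n => ->.
rewrite rnormM /u div1r mulrACA divff ?mul1r//.
by rewrite rnorm_eq0 weight_neq0.
Qed.

(** A ball around the constant |M| + 1, small enough for k_0 to vary by less than 1 on it. *)
Lemma coefficient0_large_open (M : R) :
  exists O : set E, [/\ open O, O !=set0 & forall f, O f -> M < rnorm (kf 0 f)].
Proof.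
have [C C0 kC] := coefficient_bound.
have X0 : 0 < rnorm (pol 'X^0) by rewrite rnorm_gt0 monomial_neq0.
pose c := `|M| + 1; pose f0 := pol (c%:C%C%:P).
have cf0 : rnorm (kf 0 f0) = c.
  by rewrite coefficient_pol coefC /= rnorm_real ger0_norm// addr_ge0.
pose d := rnorm (pol 'X^0) / (C + 1).
have C1 : 0 < C + 1 by rewrite ltr_wpDl.
have d0 : 0 < d by rewrite divr_gt0.
exists [set f | rnorm (f0 - f) < d]; split; first exact: open_rball.
  exact: rball_nonempty.
move=> f /= fd.
have kf1 : rnorm (kf 0 (f0 - f)) < 1.
  have := kC 0%N (f0 - f); rewrite -ler_pdivlMr// => /le_lt_trans; apply.
  rewrite ltr_pdivrMr// mul1r.
  apply: (@le_lt_trans _ _ (C * d)); first by rewrite ler_wpM2l// ltW.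
  by rewrite /d mulrA ltr_pdivrMr// mulrC ltr_pM2l//; lra.
have E1 : kf 0 f0 = kf 0 (f0 - f) + kf 0 f.
  have := coefficient_linear 0 (-1) f f0; rewrite scaleN1r [- f + f0]addrC => ->; ring.
have := rnormD (kf 0 (f0 - f)) (kf 0 f); rewrite -E1 cf0 /c.
have := ler_norm M; lra.
Qed.

(** * Necessity and sufficiency of the two criteria *)

(** If u_n >= e for all n >= N, then |k_0(B^n x)| <= C ||x|| / e for these n. Adding the first N
    values bounds k_0 on the whole orbit, which then misses a nonempty open set. *)
Lemma hypercyclic_shift_liminf : hypercyclic B ->
  forall (e : R) N, 0 < e -> exists2 n, (N <= n)%N & u n < e.
Proof.
move=> [x xdense] e N e0; apply: contrapT => nex.
have [C C0 kC] := iter_shift_coefficient0_bound.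
have [G [Go G0 GM]] := coefficient0_large_open
  (C * rnorm x / e + \sum_(0 <= n < N) rnorm (kf 0 (iter n B x))).
have [y [/GM My [n _ ny]]] := xdense G G0 Go; move: My; rewrite -ny {y ny}.
apply/negP; rewrite -leNgt.
have Cx : 0 <= C * rnorm x / e.
  by rewrite divr_ge0 ?mulr_ge0 ?rnorm_ge0// ltW.
have [Nn|nN] := leqP N n.
  rewrite -[leLHS]addr0; apply: lerD.
    rewrite ler_pdivlMr//; apply: le_trans (kC n x).
    apply: ler_wpM2l; first exact: rnorm_ge0.
    by rewrite leNgt; apply/negP => une; apply: nex; exists n.
  by apply: sumr_ge0 => i _; exact: rnorm_ge0.
rewrite -[leLHS]add0r; apply: lerD => //.
rewrite big_mkord (bigD1 (Ordinal nN))//= lerDl.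
by apply: sumr_ge0 => i _; exact: rnorm_ge0.
Qed.

(* [criterion_le_add] turns one small value [u n] into a block of [N] consecutive
   small values [u (n - N)] up to [u (n - 1)]. *)
Lemma liminf_shift_transitive :
  (forall (e : R) N, 0 < e -> exists2 n, (N <= n)%N & u n < e) ->
  topologically_transitive B.
Proof.
move=> ue U V Uo Vo U0 V0.
have [e [N [e0 eN]]] := iter_shift_meets Uo Vo U0 V0.
have [C C1 uC] := criterion_le_add.
have Cgt0 : 0 < C by exact: lt_le_trans ltr01 C1.
have eC0 : 0 < e / C ^+ N by rewrite divr_gt0 ?exprn_gt0.
(* N + N leaves n - N >= N; the factor C^N pays for going back at most N indices from n. *)
have [n Nn une] := ue _ (N + N)%N eC0.
have Nn' : (N <= n)%N by rewrite (leq_trans _ Nn)// leq_addr.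
have Nk : (N <= n - N)%N by rewrite leq_subRL.
exists (n - N)%N; apply: eN => // i iN.
have nE : n = (i + (n - N) + (N - i))%N.
  by rewrite addnAC (subnKC (ltnW iN)) subnKC.
have := uC (N - i)%N (i + (n - N))%N; rewrite -nE => /le_lt_trans; apply.
apply: (@le_lt_trans _ _ (C ^+ N * u n)).
  by rewrite ler_pM2r ?criterion_gt0// ler_weXn2l// leq_subr.
by rewrite mulrC -ltr_pdivlMr ?exprn_gt0.
Qed.

(** For large k, some f in the unit ball has |k_0(B^k f)| > (C + 1) / e, while the product of this
    value with u_k is at most C; hence u_k < e. *)
Lemma mixing_shift_cvg : mixing B -> (fun n => u n) @ \oo --> (0 : R).
Proof.
move=> mixB; apply/cvgrPdist_lt => e e0.
have [C C0 kC] := iter_shift_coefficient0_bound.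
have [G [Go G0 GM]] := coefficient0_large_open ((C + 1) / e).
have cof := mixB _ _ (@open_rball _ _ (0 : E) 1) Go (rball_nonempty 0 ltr01) G0.
have [K KP] : exists K, forall k, (K <= k)%N ->
    (iter k B @` [set y | rnorm (0 - y) < 1] `&` G) !=set0.
  have [X XE] := (iffLR (finite_seqP _)) cof.
  (* One more than the largest of the finitely many exceptional times. *)
  exists (\max_(i <- X) i).+1 => k Xk; apply: contrapT => nk.
  have kX : k \in X by have : [set` X] k by rewrite -XE.
  by move: Xk; rewrite ltnNge (@leq_bigmax_seq _ X xpredT id k).
exists K => // k /= Kk.
have [_ [[f /= f1 <-] /GM kf1]] := KP k Kk.
rewrite sub0r normrN gtr0_norm ?criterion_gt0//.
rewrite sub0r rnormN in f1.
have : rnorm (kf 0 (iter k B f)) * u k <= C.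
  apply: le_trans (kC k f) _; rewrite -[leRHS]mulr1.
  by rewrite ler_wpM2l// ltW.
move=> h; rewrite ltNge; apply/negP => eu.
have : (C + 1) / e * e <= C.
  apply: le_trans h; apply: ler_pM => //; last exact: ltW.
  - by rewrite divr_ge0 ?addr_ge0// ltW.
  - exact: ltW.
by rewrite divfK ?gt_eqF//; lra.
Qed.

(** Once u stays below e from K on, every block starting at k >= K is small, so only times below
    max(K, N) can be exceptional. *)
Lemma cvg_shift_mixing : (fun n => u n) @ \oo --> (0 : R) -> mixing B.
Proof.
move=> /cvgrPdist_lt u0 U V Uo Vo U0 V0.
have [e [N [e0 eN]]] := iter_shift_meets Uo Vo U0 V0.
have [K _ KP] := u0 e e0.
apply: (@sub_finite_set _ _ `I_(maxn K N)); last exact: finite_II.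
move=> k /= nk; rewrite ltnNge; apply/negP; rewrite geq_max => /andP[Kk Nk].
apply: nk; have [i iN|x [Ux Vx]] := eN k Nk.
  have /= := KP (i + k)%N (leq_trans Kk (leq_addl _ _)).
  by rewrite sub0r normrN gtr0_norm ?criterion_gt0.
by exists (iter k B x); split => //; exists x.
Qed.

End weighted_shift.

Theorem theorem4p4 (R : realType) (E : completeNormedModType (Cplx R))
    (ev : E -> Cplx R -> Cplx R) (pol : {poly Cplx R} -> E)
    (w : nat -> Cplx R) (B : E -> E)
    (hE : analytic_function_space ev)
    (hsep : separable_space E)
    (hev : forall z, @unit_disc R z -> continuous (fun f : E => ev f z))
    (hpol : forall p z, @unit_disc R z -> ev (pol p) z = p.[z])
    (hdense : dense (range pol))
    (hcoef : (ereal_sup (range (fun n : nat =>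
        dual_norm (fun f : E => coefficient n (ev f)) *
        (rnorm (pol 'X^n))%:E)) < +oo)%E)
    (hw : forall n : nat, (0 < n)%N -> w n != 0)
    (hB : weighted_backward_shift ev w B)
    (hBcont : continuous B) :
  let u : nat -> R := fun n =>
    1 / rnorm (\prod_(1 <= i < n.+1) w i) * rnorm (pol 'X^n) in
  (hypercyclic B <-> limn_einf (fun n => (u n)%:E) = 0%E) /\
  (mixing B <-> u @ \oo --> (0 : R)).
Proof.
move=> u.
have u0 n : 0 <= u n by apply/ltW; exact: (criterion_gt0 hE hpol hw).
split; last first.
  split; first exact: (mixing_shift_cvg hE hpol hcoef hw hB).
  exact: (cvg_shift_mixing hE hpol hdense hw hB).
apply: iff_trans (iff_sym (limn_einf_eq0P u0)); split.
  exact: (hypercyclic_shift_liminf hE hpol hcoef hw hB).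
move=> ue; apply: transitive_hypercyclic => //.
exact: (liminf_shift_transitive hE hpol hdense hw hB hBcont ue).
Qed.
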